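(* Let $\mathsf{C}$ be a partializable Markov category with conditionals. Given a morphism $u\colon A\to X\otimes Y$ in $\mathsf{Partial}(\mathsf{C})$ represented by a span $A\xleftarrow{i}D\xrightarrow{f}X\otimes Y$, the conditional $u_{|X}\colon X\otimes A\to Y$ exists and is represented by the span $$X\otimes A\xleftarrow{\mathrm{id}_X\otimes i}X\otimes D\xrightarrow{f_{|X}}Y,$$ where $f_{|X}$ is a conditional of $f$ in $\mathsf{C}$. In particular, $\mathsf{Partial}(\mathsf{C})$ has conditionals.
   Context: A CD category is a symmetric monoidal category $(\mathsf{C},\otimes,I)$ in which every object $X$ carries a commutative comonoid structure $\mathrm{copy}_X\colon X\to X\otimes X$, $\mathrm{del}_X\colon X\to I$, compatible with tensor products ($\mathrm{copy}_{X\otimes Y}$ is $\mathrm{copy}_X\otimes\mathrm{copy}_Y$ followed by swapping the two middle factors, and $\mathrm{del}_{X\otimes Y}=\mathrm{del}_X\otimes\mathrm{del}_Y$) and with $\mathrm{copy}_I=\mathrm{del}_I=\mathrm{id}_I$; coherence isomorphisms are suppressed. A morphism $f\colon X\to Y$ is total if $\mathrm{del}_Y\circ f=\mathrm{del}_X$, copyable if $\mathrm{copy}_Y\circ f=(f\otimes f)\circ\mathrm{copy}_X$, deterministic if it is both, and quasi-total if $(f\otimes(\mathrm{del}_Y\circ f))\circ\mathrm{copy}_X=f$. A Markov category is a CD category in which every morphism is total; a quasi-Markov category is a CD category in which every morphism is quasi-total. A Markov category is positive if for all $u\colon X\to Y$, $v\colon Y\to Z$ with $v\circ u$ deterministic,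 $(u\otimes (v\circ u))\circ\mathrm{copy}_X=(\mathrm{id}_Y\otimes v)\circ\mathrm{copy}_Y\circ u$. In a quasi-Markov category, a conditional of $f\colon A\to X\otimes Y$ with respect to $X$ is a morphism $f_{|X}\colon X\otimes A\to Y$ such that $$f=(\mathrm{id}_X\otimes f_{|X})\circ(\mathrm{copy}_X\otimes\mathrm{id}_A)\circ\bigl(((\mathrm{id}_X\otimes\mathrm{del}_Y)\circ f)\otimes\mathrm{id}_A\bigr)\circ\mathrm{copy}_A.$$ The category has conditionals if every such $f$ has a conditional. A Markov category $\mathsf{C}$ is partializable if: (i) it is positive; (ii) pullbacks of deterministic monomorphisms along arbitrary morphisms exist and are themselves deterministic (monomorphisms); (iii) if $i\colon D\to X$ is a deterministic monomorphism then $i\otimes\mathrm{id}_A$ is a monomorphism for every object $A$. For $\mathsf{C}$ partializable, the CD category $\mathsf{Partial}(\mathsf{C})$ (which is quasi-Markov) has the objects of $\mathsf{C}$; its morphisms $X\to Y$ are equivalence classes of spans $X\xleftarrow{i}D\xrightarrow{f}Y$ (also written $(D,i,f)$) in $\mathsf{C}$ with $i$ a deterministic monomorphism, where $(D,i,f)\sim(D',i',f')$ iff there is an isomorphism $t\colon D\to D'$ with $i'\circ t=i$, $f'\circ t=f$. The composite of $(A,i,f)\colon X\to Y$ followed by $(B,j,g)\colon Y\to Z$ is $(C,i\circ u,g\circ v)$, where $A\xleftarrow{u}C\xrightarrow{v}B$ is the pullback of $f$ and $j$. The inclusion $\mathsf{C}\hookrightarrow\mathsf{Partial}(\mathsf{C})$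 sends $f\colon X\to Y$ to $(X,\mathrm{id}_X,f)$. The tensor product is componentwise, $(A,i,f)\otimes(B,j,g)=(A\otimes B,i\otimes j,f\otimes g)$, and the copy and delete maps (and coherence isomorphisms) are the images of those of $\mathsf{C}$ under the inclusion. *)

(* Defs.v *)
From HB Require Import structures.
From mathcomp Require Import all_boot.
From mathcomp Require Import boolp.

Set Implicit Arguments.
Unset Strict Implicit.
Unset Printing Implicit Defensive.

Declare Scope cat_scope.
Delimit Scope cat_scope with cat.
Local Open Scope cat_scope.

Reserved Notation "g ∘ f" (at level 40, left associativity).
Reserved Notation "X ⊗ Y" (at level 38, left associativity).
Reserved Notation "f ⊠ g" (at level 38, left associativity).

Record category := Category {
  obj :> Type;
  hom : obj -> obj -> Type;
  idm : forall X, hom X X;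
  comp : forall X Y Z, hom Y Z -> hom X Y -> hom X Z;
  comp1m : forall X Y (f : hom X Y), comp (idm Y) f = f;
  compm1 : forall X Y (f : hom X Y), comp f (idm X) = f;
  compmA : forall X Y Z W (h : hom Z W) (g : hom Y Z) (f : hom X Y),
    comp h (comp g f) = comp (comp h g) f }.
Arguments hom {c} X Y.
Arguments idm {c} X.
Arguments comp {c X Y Z} g f.
Arguments comp1m {c X Y} f.
Arguments compm1 {c X Y} f.
Arguments compmA {c X Y Z W} h g f.
Notation "g ∘ f" := (comp g f) : cat_scope.

(* The axioms are those of Mac Lane, Categories for the Working Mathematician,
   including the two unit axioms [lunit_unit] and [lunit_braid], which are
   known to follow from the other ones. *)
Record symMonCategory := SymMonCategory {
  smc_cat :> category;
  tobj : smc_cat -> smc_cat -> smc_cat;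
  tunit : smc_cat;
  tmor : forall X Y X' Y' : smc_cat,
    hom X Y -> hom X' Y' -> hom (tobj X X') (tobj Y Y');
  assoc : forall X Y Z, hom (tobj (tobj X Y) Z) (tobj X (tobj Y Z));
  assocV : forall X Y Z, hom (tobj X (tobj Y Z)) (tobj (tobj X Y) Z);
  lunit : forall X, hom (tobj tunit X) X;
  lunitV : forall X, hom X (tobj tunit X);
  runit : forall X, hom (tobj X tunit) X;
  runitV : forall X, hom X (tobj X tunit);
  braid : forall X Y, hom (tobj X Y) (tobj Y X);
  tmor_id : forall X Y, tmor (idm X) (idm Y) = idm (tobj X Y);
  tmor_comp : forall X Y Z X' Y' Z' (g : hom Y Z) (f : hom X Y)
      (g' : hom Y' Z') (f' : hom X' Y'),
    tmor (g ∘ f) (g' ∘ f') = tmor g g' ∘ tmor f f';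
  assocK : forall X Y Z, assocV X Y Z ∘ assoc X Y Z = idm _;
  assocVK : forall X Y Z, assoc X Y Z ∘ assocV X Y Z = idm _;
  lunitK : forall X, lunitV X ∘ lunit X = idm _;
  lunitVK : forall X, lunit X ∘ lunitV X = idm _;
  runitK : forall X, runitV X ∘ runit X = idm _;
  runitVK : forall X, runit X ∘ runitV X = idm _;
  braidK : forall X Y, braid Y X ∘ braid X Y = idm _;
  assoc_nat : forall X Y Z X' Y' Z' (f : hom X X') (g : hom Y Y')
      (h : hom Z Z'),
    assoc X' Y' Z' ∘ tmor (tmor f g) h = tmor f (tmor g h) ∘ assoc X Y Z;
  lunit_nat : forall X Y (f : hom X Y),
    lunit Y ∘ tmor (idm tunit) f = f ∘ lunit X;
  runit_nat : forall X Y (f : hom X Y),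
    runit Y ∘ tmor f (idm tunit) = f ∘ runit X;
  braid_nat : forall X Y X' Y' (f : hom X X') (g : hom Y Y'),
    braid X' Y' ∘ tmor f g = tmor g f ∘ braid X Y;
  pentagon : forall X Y Z W,
    assoc X Y (tobj Z W) ∘ assoc (tobj X Y) Z W =
    tmor (idm X) (assoc Y Z W) ∘ assoc X (tobj Y Z) W
      ∘ tmor (assoc X Y Z) (idm W);
  triangle : forall X Y,
    tmor (idm X) (lunit Y) ∘ assoc X tunit Y = tmor (runit X) (idm Y);
  hexagon : forall X Y Z,
    assoc Y Z X ∘ braid X (tobj Y Z) ∘ assoc X Y Z =
    tmor (idm Y) (braid X Z) ∘ assoc Y X Z ∘ tmor (braid X Y) (idm Z);
  lunit_unit : lunit tunit = runit tunit;
  lunit_braid : forall X, lunit X ∘ braid X tunit = runit X }.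
Arguments tobj {s} X Y.
Arguments tunit {s}.
Arguments tmor {s X Y X' Y'} f g.
Arguments assoc {s} X Y Z.
Arguments assocV {s} X Y Z.
Arguments lunit {s} X.
Arguments lunitV {s} X.
Arguments runit {s} X.
Arguments runitV {s} X.
Arguments braid {s} X Y.
Notation "X ⊗ Y" := (tobj X Y) : cat_scope.
Notation "f ⊠ g" := (tmor f g) : cat_scope.

(* (A ⊗ B) ⊗ (C ⊗ D) -> (A ⊗ C) ⊗ (B ⊗ D) *)
Definition midswap (S : symMonCategory) (A B C D : S) :
    hom ((A ⊗ B) ⊗ (C ⊗ D)) ((A ⊗ C) ⊗ (B ⊗ D)) :=
  assocV A C (B ⊗ D)
    ∘ (idm A ⊠ (assoc C B D ∘ (braid B C ⊠ idm D) ∘ assocV B C D))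
    ∘ assoc A B (C ⊗ D).
Arguments midswap {S} A B C D.

Record cdCategory := CDCategory {
  cd_smc :> symMonCategory;
  copy : forall X : cd_smc, hom X (X ⊗ X);
  del : forall X : cd_smc, hom X tunit;
  copyA : forall X : cd_smc,
    assoc X X X ∘ (copy X ⊠ idm X) ∘ copy X = (idm X ⊠ copy X) ∘ copy X;
  copyC : forall X : cd_smc, braid X X ∘ copy X = copy X;
  copy_dell : forall X : cd_smc,
    lunit X ∘ (del X ⊠ idm X) ∘ copy X = idm X;
  copy_delr : forall X : cd_smc,
    runit X ∘ (idm X ⊠ del X) ∘ copy X = idm X;
  copy_tobj : forall X Y : cd_smc,
    copy (X ⊗ Y) = midswap X X Y Y ∘ (copy X ⊠ copy Y);
  del_tobj : forall X Y : cd_smc,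
    del (X ⊗ Y) = lunit tunit ∘ (del X ⊠ del Y);
  copy_tunit : copy tunit = lunitV tunit;
  del_tunit : del tunit = idm tunit }.
Arguments copy {c} X.
Arguments del {c} X.

Section Notions.
Variable C : cdCategory.
Implicit Types X Y Z A D : C.

Definition total X Y (f : hom X Y) := del Y ∘ f = del X.

Definition copyable X Y (f : hom X Y) := copy Y ∘ f = (f ⊠ f) ∘ copy X.

Definition deterministic X Y (f : hom X Y) := total f /\ copyable f.

Definition quasi_total X Y (f : hom X Y) :=
  runit Y ∘ (f ⊠ (del Y ∘ f)) ∘ copy X = f.

Definition mono X Y (f : hom X Y) :=
  forall W (g h : hom W X), f ∘ g = f ∘ h -> g = h.

Definition det_mono X Y (f : hom X Y) := deterministic f /\ mono f.

Definition is_iso X Y (f : hom X Y) :=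
  exists g : hom Y X, g ∘ f = idm X /\ f ∘ g = idm Y.

Definition is_pullback X Y Z P (f : hom X Z) (g : hom Y Z)
    (p : hom P X) (q : hom P Y) :=
  f ∘ p = g ∘ q /\
  forall W (a : hom W X) (b : hom W Y), f ∘ a = g ∘ b ->
    exists! h : hom W P, p ∘ h = a /\ q ∘ h = b.

(* The unitor and associator here and in [is_conditional], like the unitor in
   [quasi_total], are the coherence isomorphisms left implicit on paper. *)
Definition marginal X Y A (f : hom A (X ⊗ Y)) : hom A X :=
  runit X ∘ (idm X ⊠ del Y) ∘ f.

Definition is_conditional X Y A (f : hom A (X ⊗ Y)) (c : hom (X ⊗ A) Y) :=
  f = (idm X ⊠ c) ∘ assoc X X A ∘ (copy X ⊠ idm A)
        ∘ (marginal f ⊠ idm A) ∘ copy A.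

End Notions.

Definition is_markov (C : cdCategory) :=
  forall (X Y : C) (f : hom X Y), total f.

Definition is_quasi_markov (C : cdCategory) :=
  forall (X Y : C) (f : hom X Y), quasi_total f.

Definition is_positive (C : cdCategory) :=
  forall (X Y Z : C) (u : hom X Y) (v : hom Y Z), deterministic (v ∘ u) ->
    (u ⊠ (v ∘ u)) ∘ copy X = (idm Y ⊠ v) ∘ copy Y ∘ u.

Definition has_conditionals (C : cdCategory) :=
  forall (X Y A : C) (f : hom A (X ⊗ Y)), exists c, is_conditional f c.

Record partializable (C : cdCategory) : Prop := Partializable {
  part_markov : is_markov C;
  part_positive : is_positive C;
  part_pullback : forall (X Y D : C) (f : hom X Y) (i : hom D Y), det_mono i ->
    exists (P : C) (p : hom P X) (q : hom P D), is_pullback f i p q;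
  part_pullback_det : forall (X Y D P : C) (f : hom X Y) (i : hom D Y)
      (p : hom P X) (q : hom P D),
    det_mono i -> is_pullback f i p q -> det_mono p;
  part_tensor : forall (D X A : C) (i : hom D X),
    det_mono i -> mono (i ⊠ idm A) }.

Section Calculus.
Variable C : cdCategory.
Implicit Types X Y Z W A B D E P : C.

Lemma tmor1_comp X Y Z A (g : hom Y Z) (f : hom X Y) :
  idm A ⊠ (g ∘ f) = (idm A ⊠ g) ∘ (idm A ⊠ f).
Proof. by rewrite -tmor_comp comp1m. Qed.

Lemma tmor_comp1 X Y Z A (g : hom Y Z) (f : hom X Y) :
  (g ∘ f) ⊠ idm A = (g ⊠ idm A) ∘ (f ⊠ idm A).
Proof. by rewrite -tmor_comp comp1m. Qed.

Lemma assocV_nat X Y Z X' Y' Z' (f : hom X X') (g : hom Y Y') (h : hom Z Z') :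
  assocV X' Y' Z' ∘ (f ⊠ (g ⊠ h)) = ((f ⊠ g) ⊠ h) ∘ assocV X Y Z.
Proof.
rewrite -[LHS]compm1 -(assocVK X Y Z) compmA -(compmA _ _ (assoc _ _ _)).
by rewrite -assoc_nat compmA assocK comp1m.
Qed.

Lemma midswap_nat A B D E A' B' D' E' (a : hom A A') (b : hom B B')
    (d : hom D D') (e : hom E E') :
  midswap A' B' D' E' ∘ ((a ⊠ b) ⊠ (d ⊠ e)) =
  ((a ⊠ d) ⊠ (b ⊠ e)) ∘ midswap A B D E.
Proof.
rewrite /midswap -!compmA assoc_nat !compmA -assocV_nat -!compmA; congr comp.
rewrite !compmA -!tmor_comp comp1m compm1; congr comp; congr tmor.
rewrite -!compmA assocV_nat !compmA -assoc_nat -!compmA; congr comp.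
by rewrite !compmA -!tmor_comp comp1m compm1 braid_nat.
Qed.

Lemma braid_unit : braid tunit tunit = idm (@tunit C ⊗ tunit).
Proof.
by rewrite -[LHS]comp1m -(lunitK tunit) -compmA lunit_braid -lunit_unit.
Qed.

Lemma midswap_unit X Y : midswap X tunit tunit Y = idm _.
Proof.
rewrite /midswap braid_unit tmor_id compm1 assocVK tmor_id compm1.
exact: assocK.
Qed.

Definition fstm X Y : hom (X ⊗ Y) X := runit X ∘ (idm X ⊠ del Y).
Definition sndm X Y : hom (X ⊗ Y) Y := lunit Y ∘ (del X ⊠ idm Y).

Lemma copy_proj X Y : (fstm X Y ⊠ sndm X Y) ∘ copy (X ⊗ Y) = idm _.
Proof.
rewrite copy_tobj /fstm /sndm tmor_comp compmA -(compmA _ _ (midswap _ _ _ _)).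
rewrite -midswap_nat midswap_unit comp1m -!tmor_comp.
by rewrite copy_delr copy_dell tmor_id.
Qed.

Lemma fst_pair A X Y (f : hom A X) (g : hom A Y) :
  total g -> fstm X Y ∘ (f ⊠ g) ∘ copy A = f.
Proof.
move=> g1; rewrite /fstm -(compmA (runit X)) -tmor_comp comp1m g1.
have -> : f ⊠ del A = (f ⊠ idm tunit) ∘ (idm A ⊠ del A).
  by rewrite -tmor_comp comp1m compm1.
by rewrite compmA runit_nat -!compmA (compmA (runit A)) copy_delr compm1.
Qed.

Lemma fst_nat X Y X' Y' (f : hom X X') (g : hom Y Y') :
  total g -> fstm X' Y' ∘ (f ⊠ g) = f ∘ fstm X Y.
Proof.
move=> g1; rewrite /fstm -compmA -tmor_comp comp1m g1 compmA -runit_nat.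
by rewrite -compmA -tmor_comp compm1 comp1m.
Qed.

Lemma snd_nat X Y X' Y' (f : hom X X') (g : hom Y Y') :
  total f -> sndm X' Y' ∘ (f ⊠ g) = g ∘ sndm X Y.
Proof.
move=> f1; rewrite /sndm -compmA -tmor_comp comp1m f1 compmA -lunit_nat.
by rewrite -compmA -tmor_comp compm1 comp1m.
Qed.

Lemma mono_comp X Y Z (g : hom Y Z) (f : hom X Y) :
  mono g -> mono f -> mono (g ∘ f).
Proof. by move=> gM fM W a b; rewrite -!compmA => /gM /fM. Qed.

Lemma mono_split X Y (f : hom X Y) (g : hom Y X) : g ∘ f = idm X -> mono f.
Proof.
by move=> gf W a b /(congr1 (comp g)); rewrite !compmA gf !comp1m.
Qed.

Lemma det_mono_id X : det_mono (idm X).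
Proof.
split; last by apply: (@mono_split _ _ _ (idm X)); rewrite comp1m.
by split; rewrite /total /copyable compm1 // tmor_id comp1m.
Qed.

Lemma det_mono_comp X Y Z (g : hom Y Z) (f : hom X Y) :
  det_mono g -> det_mono f -> det_mono (g ∘ f).
Proof.
move=> [[g1 g2] gM] [[f1 f2] fM]; split; last exact: mono_comp.
split; first by rewrite /total compmA g1.
by rewrite /copyable compmA g2 -compmA f2 compmA -tmor_comp.
Qed.

Lemma is_iso_id X : is_iso (idm X).
Proof. by exists (idm X); rewrite comp1m. Qed.

Lemma pullback_mono X Y Z P (f : hom X Z) (j : hom Y Z)
    (p : hom P X) (q : hom P Y) :
  mono j -> mono p -> f ∘ p = j ∘ q ->
  (forall W (a : hom W X) (b : hom W Y), f ∘ a = j ∘ b ->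
    exists h : hom W P, p ∘ h = a) ->
  is_pullback f j p q.
Proof.
move=> jM pM e H; split=> // W a b ab; have [h ph] := H _ _ _ ab.
exists h; split; last by move=> h' [ph' _]; apply: pM; rewrite ph ph'.
by split=> //; apply: jM; rewrite compmA -e -compmA ph.
Qed.

Lemma pullback_ex X Y Z P (f : hom X Z) (j : hom Y Z) (p : hom P X)
    (q : hom P Y) W (a : hom W X) (b : hom W Y) :
  is_pullback f j p q -> f ∘ a = j ∘ b ->
  exists h : hom W P, p ∘ h = a /\ q ∘ h = b.
Proof. by move=> [_ H] /H [h [? _]]; exists h. Qed.

End Calculus.

(* Spans X <- D -> Y whose left leg is a deterministic monomorphism, up to
   isomorphism. The quotient is taken classically: [asbool] turns the relation
   into a boolean one and [span] is given a choice structure by axiom. *)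
Record span (C : cdCategory) (X Y : C) := Span {
  sdom : C;
  sleg : hom sdom X;
  smap : hom sdom Y;
  sleg_dm : det_mono sleg }.
Arguments Span {C X Y sdom} sleg smap sleg_dm.

Section SpanQuotient.
Variables (C : cdCategory) (X Y : C).

Definition span_equiv (s s' : span X Y) : Prop :=
  exists t : hom (sdom s) (sdom s'),
    [/\ is_iso t, sleg s' ∘ t = sleg s & smap s' ∘ t = smap s].

Definition span_eqb (s s' : span X Y) : bool := `[< span_equiv s s' >].

Lemma span_eqb_refl : reflexive span_eqb.
Proof.
move=> s; apply/asboolP; exists (idm _).
by split; rewrite ?compm1 //; apply: is_iso_id.
Qed.

Lemma span_equiv_sym s s' : span_equiv s s' -> span_equiv s' s.
Proof.
move=> [t [[r [rt tr]] e1 e2]]; exists r; split; first by exists t.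
- by rewrite -e1 -compmA tr compm1.
- by rewrite -e2 -compmA tr compm1.
Qed.

Lemma span_eqb_sym : symmetric span_eqb.
Proof. by move=> s s'; apply/asboolP/asboolP; apply: span_equiv_sym. Qed.

Lemma span_eqb_trans : transitive span_eqb.
Proof.
move=> s2 s1 s3 /asboolP[t [[r [rt tr]] e1 e2]].
move=> /asboolP[t' [[r' [rt' tr']] e1' e2']].
apply/asboolP; exists (t' ∘ t); split.
- exists (r ∘ r'); split.
    by rewrite -compmA (compmA r') rt' comp1m.
  by rewrite -compmA (compmA t) tr comp1m.
- by rewrite compmA e1'.
- by rewrite compmA e2'.
Qed.

HB.instance Definition _ := gen_eqMixin (span X Y).
HB.instance Definition _ := gen_choiceMixin (span X Y).

Canonical span_equivRel :=
  EquivRel span_eqb span_eqb_refl span_eqb_sym span_eqb_trans.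

Definition phom := {eq_quot span_eqb}%qT.

Definition pclass (s : span X Y) : phom := (\pi_phom s)%qT.
Definition prepr (u : phom) : span X Y := repr u.

Lemma preprK u : pclass (prepr u) = u.
Proof. exact: reprK. Qed.

Lemma pclassP s s' : pclass s = pclass s' <-> span_equiv s s'.
Proof.
by split=> [/eqmodP/asboolP|ss']; last by apply/eqmodP/asboolP.
Qed.

Definition pspan D (i : hom D X) (f : hom D Y) (Hi : det_mono i) : phom :=
  pclass (Span i f Hi).

Definition represents (u : phom) D (i : hom D X) (f : hom D Y) :=
  exists Hi : det_mono i, u = pspan f Hi.

Lemma pspan_ind (Q : phom -> Prop) :
  (forall D (i : hom D X) (f : hom D Y) (Hi : det_mono i), Q (pspan f Hi)) ->
  forall u, Q u.
Proof.
by move=> H u; rewrite -(preprK u); case: (prepr u) => D i f Hi; apply: H.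
Qed.

Lemma pspan_eq D D' (i : hom D X) (f : hom D Y) (i' : hom D' X)
    (f' : hom D' Y) (Hi : det_mono i) (Hi' : det_mono i') (t : hom D D') :
  is_iso t -> i' ∘ t = i -> f' ∘ t = f -> pspan f Hi = pspan f' Hi'.
Proof. by move=> tI e1 e2; apply/pclassP; exists t. Qed.

Lemma pspan_eq1 D (i i' : hom D X) (f f' : hom D Y) (Hi : det_mono i)
  (Hi' : det_mono i') : i = i' -> f = f' -> pspan f Hi = pspan f' Hi'.
Proof.
move=> e1 e2; apply: (@pspan_eq _ _ _ _ _ _ _ _ (idm D)).
  exact: is_iso_id.
  by rewrite compm1.
by rewrite compm1.
Qed.

End SpanQuotient.

Section Partial.
Variables (C : cdCategory) (HC : partializable C).
Implicit Types X Y Z W A B D E P : C.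

Record pb X Y D (f : hom X Y) (i : hom D Y) := Pb {
  pb_obj : C;
  pb_fst : hom pb_obj X;
  pb_snd : hom pb_obj D;
  pbP : is_pullback f i pb_fst pb_snd }.

Lemma pb_ex X Y D (f : hom X Y) (i : hom D Y) (Hi : det_mono i) :
  exists _ : pb f i, True.
Proof.
by have [P [p [q H]]] := part_pullback HC f Hi; exists (Pb H).
Qed.

(* The pullback is picked by classical choice; [pcompE] shows that the
   resulting composition of classes depends neither on it nor on the
   representatives. *)
Definition pb_choice X Y D (f : hom X Y) (i : hom D Y) (Hi : det_mono i) :
  pb f i := projT1 (cid (pb_ex f Hi)).

Definition span_comp X Y Z (t : span Y Z) (s : span X Y) : span X Z :=
  let P := pb_choice (smap s) (sleg_dm t) in
  Span (sleg s ∘ pb_fst P) (smap t ∘ pb_snd P)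
    (det_mono_comp (sleg_dm s) (part_pullback_det HC (sleg_dm t) (pbP P))).

Definition partial_comp X Y Z (v : phom Y Z) (u : phom X Y) : phom X Z :=
  pclass (span_comp (prepr v) (prepr u)).

Lemma tmor_mono_r A D X (i : hom D X) : det_mono i -> mono (idm A ⊠ i).
Proof.
move=> Hi W a b e; have := part_tensor HC (A := A) Hi.
move=> /(_ _ (braid _ _ ∘ a) (braid _ _ ∘ b)).
rewrite !compmA -!braid_nat -!compmA.
rewrite e => /(_ erefl) /(congr1 (comp (braid _ _))).
by rewrite !compmA !braidK !comp1m.
Qed.

Lemma det_mono_tmor D X D' X' (i : hom D X) (i' : hom D' X') :
  det_mono i -> det_mono i' -> det_mono (i ⊠ i').
Proof.
move=> Hi Hi'; split; last first.
  rewrite -[i]compm1 -[i']comp1m tmor_comp; apply: mono_comp.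
    exact: (part_tensor HC).
  exact: tmor_mono_r.
move: Hi Hi' => [[i1 i2] _] [[j1 j2] _]; split.
  by rewrite /total !del_tobj -compmA -tmor_comp i1 j1.
rewrite /copyable !copy_tobj -compmA -tmor_comp i2 j2 tmor_comp.
by rewrite compmA midswap_nat -(compmA _ (midswap _ _ _ _)).
Qed.

Definition span_tmor X Y X' Y' (s : span X Y) (s' : span X' Y') :
    span (X ⊗ X') (Y ⊗ Y') :=
  Span (sleg s ⊠ sleg s') (smap s ⊠ smap s')
    (det_mono_tmor (sleg_dm s) (sleg_dm s')).

Definition ptmor X Y X' Y' (u : phom X Y) (u' : phom X' Y') :
    phom (X ⊗ X') (Y ⊗ Y') :=
  pclass (span_tmor (prepr u) (prepr u')).

Definition pinc X Y (f : hom X Y) : phom X Y := pspan f (det_mono_id X).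

Lemma pcompE X Y Z A B P (i : hom A X) (f : hom A Y) (j : hom B Y)
    (g : hom B Z) (Hi : det_mono i) (Hj : det_mono j) (p : hom P A)
    (q : hom P B) (H : det_mono (i ∘ p)) :
  is_pullback f j p q ->
  partial_comp (pspan g Hj) (pspan f Hi) = pspan (g ∘ q) H.
Proof.
move=> PB; rewrite /partial_comp; set s0 := prepr _; set t0 := prepr _.
have /pclassP : pclass s0 = pclass (Span j g Hj) by rewrite /s0 preprK.
have /pclassP : pclass t0 = pclass (Span i f Hi) by rewrite /t0 preprK.
case: t0 => A' i' f' Hi' [/= t [[t' [t't tt']] /= ti tf]].
case: s0 => B' j' g' Hj' [/= r [[r' [r'r rr']] /= rj rg]].
rewrite /span_comp /=; set K := pb_choice _ _.
move: (part_pullback_det _ _ _) => KM; case: K KM => K k l PB' /= KM.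
have kM : mono k by case: KM.
have pM : mono p by case: (part_pullback_det HC Hj PB).
have [h [ph qh]] : exists h, p ∘ h = t ∘ k /\ q ∘ h = r ∘ l.
  apply: (pullback_ex PB); rewrite !compmA tf rj.
  by case: PB'.
have [h' [kh' lh']] : exists h', k ∘ h' = t' ∘ p /\ l ∘ h' = r' ∘ q.
  apply: (pullback_ex PB'); rewrite -tf -rj !compmA.
  rewrite -(compmA f) tt' -(compmA j) rr' !compm1.
  by case: PB.
apply/pclassP; exists h; split=> /=.
- exists h'; split.
    by apply: kM; rewrite compmA kh' -compmA ph compmA t't comp1m compm1.
  by apply: pM; rewrite compmA ph -compmA kh' compmA tt' comp1m compm1.
- by rewrite -compmA ph compmA ti.
- by rewrite -compmA qh compmA rg.
Qed.

Lemma ptmorE X Y X' Y' D D' (i : hom D X) (f : hom D Y) (i' : hom D' X')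
    (f' : hom D' Y') (Hi : det_mono i) (Hi' : det_mono i')
    (H : det_mono (i ⊠ i')) :
  ptmor (pspan f Hi) (pspan f' Hi') = pspan (f ⊠ f') H.
Proof.
rewrite /ptmor; set s0 := prepr _; set t0 := prepr _.
have /pclassP : pclass s0 = pclass (Span i f Hi) by rewrite /s0 preprK.
have /pclassP : pclass t0 = pclass (Span i' f' Hi') by rewrite /t0 preprK.
case: t0 => A j g Hj [/= t [[t' [t't tt']] /= ti tf]].
case: s0 => A' j' g' Hj' [/= r [[r' [r'r rr']] /= rj rg]].
apply/pclassP; exists (r ⊠ t); split=> /=; last 2 first.
- by rewrite -tmor_comp rj ti.
- by rewrite -tmor_comp rg tf.
by exists (r' ⊠ t'); rewrite -!tmor_comp t't tt' r'r rr' !tmor_id.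
Qed.

Lemma ptmor_span X Y X' Y' D D' (i : hom D X) (f : hom D Y) (i' : hom D' X')
    (f' : hom D' Y') (Hi : det_mono i) (Hi' : det_mono i') :
  ptmor (pspan f Hi) (pspan f' Hi') = pspan (f ⊠ f') (det_mono_tmor Hi Hi').
Proof. exact: ptmorE. Qed.

(* If the right leg factors through the domain of the next span, the
   composite is the evident one. *)
Lemma pcomp_fact X Y Z A B (i : hom A X) (f : hom A Y) (j : hom B Y)
    (g : hom B Z) (Hi : det_mono i) (Hj : det_mono j) (f' : hom A B) :
  f = j ∘ f' -> partial_comp (pspan g Hj) (pspan f Hi) = pspan (g ∘ f') Hi.
Proof.
move=> ff'; have H : det_mono (i ∘ idm A) by rewrite compm1.
rewrite (pcompE (p := idm A) (q := f') _ _ _ H).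
  by apply: pspan_eq1; rewrite ?compm1.
apply: pullback_mono; first by case: Hj.
- by case: (det_mono_id A).
- by rewrite compm1.
- by move=> W a b _; exists a; rewrite comp1m.
Qed.

Lemma pcomp_inc X Y Z A (i : hom A X) (f : hom A Y) (g : hom Y Z)
  (Hi : det_mono i) : partial_comp (pinc g) (pspan f Hi) = pspan (g ∘ f) Hi.
Proof. by apply: pcomp_fact; rewrite comp1m. Qed.

Lemma pinc_comp X Y Z (g : hom Y Z) (f : hom X Y) :
  pinc (g ∘ f) = partial_comp (pinc g) (pinc f).
Proof. by rewrite pcomp_inc. Qed.

Lemma pinc_tmor X Y X' Y' (f : hom X Y) (g : hom X' Y') :
  ptmor (pinc f) (pinc g) = pinc (f ⊠ g).
Proof.
have H : det_mono (idm X ⊠ idm X') by rewrite tmor_id; apply: det_mono_id.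
by rewrite (ptmorE _ _ _ _ H); apply: pspan_eq1; rewrite ?tmor_id.
Qed.

(* Precomposition with a map along which the pullback of [j] is visible. *)
Lemma pcomp_pinc X Y Z B P (a : hom X Y) (j : hom B Y) (g : hom B Z)
    (Hj : det_mono j) (p : hom P X) (q : hom P B) (Hp : det_mono p) :
  is_pullback a j p q ->
  partial_comp (pspan g Hj) (pinc a) = pspan (g ∘ q) Hp.
Proof.
move=> PB; have H : det_mono (idm X ∘ p) by rewrite comp1m.
by rewrite (pcompE _ _ _ H PB); apply: pspan_eq1; rewrite ?comp1m.
Qed.

Lemma pcomp_pinc_iso X Y Z B P (a : hom X Y) (aV : hom Y X) (j : hom B Y)
    (g : hom B Z) (Hj : det_mono j) (p : hom P X) (q : hom P B)
    (qV : hom B P) (Hp : det_mono p) :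
  aV ∘ a = idm X -> q ∘ qV = idm B -> a ∘ p = j ∘ q ->
  partial_comp (pspan g Hj) (pinc a) = pspan (g ∘ q) Hp.
Proof.
move=> aVa qqV e; apply: pcomp_pinc; apply: pullback_mono => //.
- by case: Hj.
- by case: Hp.
move=> W x y xy; exists (qV ∘ y); apply: (mono_split aVa).
by rewrite !compmA e -(compmA j) qqV compm1.
Qed.

Lemma pcomp1m X Y (u : phom X Y) : partial_comp (pinc (idm Y)) u = u.
Proof. by elim/pspan_ind: u => D i f Hi; rewrite pcomp_inc comp1m. Qed.

Lemma pcompm1 X Y (u : phom X Y) : partial_comp u (pinc (idm X)) = u.
Proof.
elim/pspan_ind: u => D i f Hi.
rewrite (pcomp_pinc_iso (aV := idm X) (q := idm D) (qV := idm D) _ _ Hi);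
  by rewrite ?compm1 ?comp1m.
Qed.

Lemma pcompA X Y Z W (w : phom Z W) (v : phom Y Z) (u : phom X Y) :
  partial_comp w (partial_comp v u) = partial_comp (partial_comp w v) u.
Proof.
elim/pspan_ind: u => A i f Hi; elim/pspan_ind: v => B j g Hj.
elim/pspan_ind: w => E k h Hk.
have [P [p [q PB]]] := part_pullback HC f Hj.
have [R [r1 [r2 PBR]]] := part_pullback HC g Hk.
have Hp := part_pullback_det HC Hj PB.
have Hr := part_pullback_det HC Hk PBR.
have [Q [r [s PBQ]]] := part_pullback HC (g ∘ q) Hk.
have HQ := part_pullback_det HC Hk PBQ.
have Hip := det_mono_comp Hi Hp; have Hjr := det_mono_comp Hj Hr.
have Hpr := det_mono_comp Hp HQ.
have Hipr := det_mono_comp Hip HQ.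
have Hipr' := det_mono_comp Hi Hpr.
have [m [rm sm]] : exists m, r1 ∘ m = q ∘ r /\ r2 ∘ m = s.
  by apply: (pullback_ex PBR); rewrite compmA; case: PBQ.
rewrite (pcompE _ _ _ Hip PB) (pcompE _ _ _ Hjr PBR) (pcompE _ _ _ Hipr PBQ).
rewrite (pcompE (p := p ∘ r) (q := m) _ _ _ Hipr').
  by apply: pspan_eq1; rewrite ?compmA // -compmA sm.
apply: pullback_mono; [by case: Hjr|by case: Hpr| |].
  by rewrite -(compmA j) rm !compmA; case: PB => ->.
move=> V a b; rewrite -compmA => ab.
have [x [px qx]] := pullback_ex PB ab.
have [y [ry _]] : exists y, r ∘ y = x /\ s ∘ y = r2 ∘ b.
  apply: (pullback_ex PBQ); rewrite -compmA qx !compmA.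
  by case: PBR => ->.
by exists y; rewrite -compmA ry.
Qed.

(* A joint morphism whose two marginals factor through deterministic
   monomorphisms factors through their tensor product. *)
Lemma tmor_fact A A' D D' W (i : hom D A) (i' : hom D' A')
    (a : hom W (A ⊗ A')) (c : hom W D) (c' : hom W D') : det_mono i -> det_mono i' ->
  fstm A A' ∘ a = i ∘ c -> sndm A A' ∘ a = i' ∘ c' ->
  exists h, (i ⊠ i') ∘ h = a.
Proof.
move=> Hi Hi' e e'.
have [M [m [x PB]]] := part_pullback HC (fstm A A') Hi.
have Hm := part_pullback_det HC Hi PB.
have [N [n [y PB']]] := part_pullback HC (sndm A A' ∘ m) Hi'.
have Hn := part_pullback_det HC Hi' PB'.
have [a1 [ma1 _]] := pullback_ex PB e.
have [a2 [na2 _]] : exists a2, n ∘ a2 = a1 /\ y ∘ a2 = c'.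
  by apply: (pullback_ex PB'); rewrite -compmA ma1.
have [[_ mc] _] := det_mono_comp Hm Hn.
exists ((x ∘ n) ⊠ y ∘ copy N ∘ a2).
rewrite -ma1 -na2 !compmA; congr comp.
rewrite -[RHS]comp1m -copy_proj -!compmA mc !compmA -!tmor_comp.
by rewrite !compmA; case: PB PB' => -> _ [-> _].
Qed.

Lemma tmor_pullback A B P Y A' B' P' Y' (f : hom A Y) (j : hom B Y)
    (p : hom P A) (q : hom P B) (f' : hom A' Y') (j' : hom B' Y')
    (p' : hom P' A') (q' : hom P' B') :
  det_mono j -> det_mono j' -> is_pullback f j p q -> is_pullback f' j' p' q' ->
  is_pullback (f ⊠ f') (j ⊠ j') (p ⊠ p') (q ⊠ q').
Proof.
move=> Hj Hj' PB PB'.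
have Hp := part_pullback_det HC Hj PB.
have Hp' := part_pullback_det HC Hj' PB'.
apply: pullback_mono; [by case: (det_mono_tmor Hj Hj')
  |by case: (det_mono_tmor Hp Hp')| |].
  by rewrite -!tmor_comp; case: PB PB' => -> _ [-> _].
move=> W a b e.
have T := part_markov HC.
have [x [px _]] : exists x, p ∘ x = fstm _ _ ∘ a /\ q ∘ x = fstm _ _ ∘ b.
  apply: (pullback_ex PB).
  by rewrite (compmA f) (compmA j) -(fst_nat f (T _ _ f')) -(fst_nat j (T _ _ j'))
    -(compmA _ (f ⊠ f')) -(compmA _ (j ⊠ j')) e.
have [y [py _]] : exists y, p' ∘ y = sndm _ _ ∘ a /\ q' ∘ y = sndm _ _ ∘ b.
  apply: (pullback_ex PB').
  by rewrite (compmA f') (compmA j') -(snd_nat f' (T _ _ f)) -(snd_nat j' (T _ _ j))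
    -(compmA _ (f ⊠ f')) -(compmA _ (j ⊠ j')) e.
exact: (tmor_fact Hp Hp' (esym px) (esym py)).
Qed.

Lemma ptmor_comp X Y Z X' Y' Z' (v : phom Y Z) (u : phom X Y)
    (v' : phom Y' Z') (u' : phom X' Y') :
  ptmor (partial_comp v u) (partial_comp v' u') =
  partial_comp (ptmor v v') (ptmor u u').
Proof.
elim/pspan_ind: u => A i f Hi; elim/pspan_ind: v => B j g Hj.
elim/pspan_ind: u' => A' i' f' Hi'; elim/pspan_ind: v' => B' j' g' Hj'.
have [P [p [q PB]]] := part_pullback HC f Hj.
have [P' [p' [q' PB']]] := part_pullback HC f' Hj'.
have Hp := part_pullback_det HC Hj PB.
have Hp' := part_pullback_det HC Hj' PB'.
have Hip := det_mono_comp Hi Hp; have Hip' := det_mono_comp Hi' Hp'.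
rewrite (pcompE _ _ _ Hip PB) (pcompE _ _ _ Hip' PB').
rewrite !ptmor_span.
have H := det_mono_comp (det_mono_tmor Hi Hi') (det_mono_tmor Hp Hp').
rewrite (pcompE _ _ _ H (tmor_pullback Hj Hj' PB PB')).
by apply: pspan_eq1; rewrite tmor_comp.
Qed.

Lemma passoc_nat X Y Z X' Y' Z' (u : phom X X') (v : phom Y Y')
    (w : phom Z Z') :
  partial_comp (pinc (assoc X' Y' Z')) (ptmor (ptmor u v) w) =
  partial_comp (ptmor u (ptmor v w)) (pinc (assoc X Y Z)).
Proof.
elim/pspan_ind: u => A i f Hi; elim/pspan_ind: v => B j g Hj.
elim/pspan_ind: w => D k h Hk.
rewrite !ptmor_span pcomp_inc assoc_nat; symmetry.
apply: pcomp_pinc_iso.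
- exact: assocK.
- exact: assocVK.
- exact: assoc_nat.
Qed.

Lemma plunit_nat X Y (u : phom X Y) :
  partial_comp (pinc (lunit Y)) (ptmor (pinc (idm tunit)) u) =
  partial_comp u (pinc (lunit X)).
Proof.
elim/pspan_ind: u => A i f Hi.
rewrite !ptmor_span pcomp_inc lunit_nat; symmetry.
apply: pcomp_pinc_iso.
- exact: lunitK.
- exact: lunitVK.
- exact: lunit_nat.
Qed.

Lemma prunit_nat X Y (u : phom X Y) :
  partial_comp (pinc (runit Y)) (ptmor u (pinc (idm tunit))) =
  partial_comp u (pinc (runit X)).
Proof.
elim/pspan_ind: u => A i f Hi.
rewrite !ptmor_span pcomp_inc runit_nat; symmetry.
apply: pcomp_pinc_iso.
- exact: runitK.
- exact: runitVK.
- exact: runit_nat.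
Qed.

Lemma pbraid_nat X Y X' Y' (u : phom X X') (v : phom Y Y') :
  partial_comp (pinc (braid X' Y')) (ptmor u v) =
  partial_comp (ptmor v u) (pinc (braid X Y)).
Proof.
elim/pspan_ind: u => A i f Hi; elim/pspan_ind: v => B j g Hj.
rewrite !ptmor_span pcomp_inc braid_nat; symmetry.
apply: pcomp_pinc_iso.
- exact: braidK.
- exact: braidK.
- exact: braid_nat.
Qed.

Definition Partial_cat : category :=
  @Category C (@phom C) (fun X => pinc (idm X)) partial_comp
    pcomp1m pcompm1 pcompA.

Definition Partial_smc : symMonCategory.
Proof.
refine (@SymMonCategory Partial_cat (fun X Y => X ⊗ Y) (@tunit C) ptmor
  (fun X Y Z => pinc (assoc X Y Z)) (fun X Y Z => pinc (assocV X Y Z))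
  (fun X => pinc (lunit X)) (fun X => pinc (lunitV X))
  (fun X => pinc (runit X)) (fun X => pinc (runitV X))
  (fun X Y => pinc (braid X Y)) _ ptmor_comp _ _ _ _ _ _ _
  passoc_nat plunit_nat prunit_nat pbraid_nat _ _ _ _ _) => /=.
- by move=> X Y; rewrite pinc_tmor tmor_id.
- by move=> X Y Z; rewrite -pinc_comp assocK.
- by move=> X Y Z; rewrite -pinc_comp assocVK.
- by move=> X; rewrite -pinc_comp lunitK.
- by move=> X; rewrite -pinc_comp lunitVK.
- by move=> X; rewrite -pinc_comp runitK.
- by move=> X; rewrite -pinc_comp runitVK.
- by move=> X Y; rewrite -pinc_comp braidK.
- by move=> X Y Z W; rewrite !pinc_tmor -!pinc_comp pentagon.
- by move=> X Y; rewrite !pinc_tmor -!pinc_comp triangle.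
- by move=> X Y Z; rewrite !pinc_tmor -!pinc_comp hexagon.
- by rewrite lunit_unit.
- by move=> X; rewrite -pinc_comp lunit_braid.
Defined.

Definition Partial : cdCategory.
Proof.
refine (@CDCategory Partial_smc (fun X => pinc (copy (X : C)))
  (fun X => pinc (del (X : C))) _ _ _ _ _ _ _ _) => /=.
- by move=> X; rewrite !pinc_tmor -!pinc_comp copyA.
- by move=> X; rewrite -!pinc_comp copyC.
- by move=> X; rewrite !pinc_tmor -!pinc_comp copy_dell.
- by move=> X; rewrite !pinc_tmor -!pinc_comp copy_delr.
- by move=> X Y; rewrite /midswap /= !pinc_tmor -!pinc_comp
    !pinc_tmor -!pinc_comp copy_tobj.
- by move=> X Y; rewrite !pinc_tmor -!pinc_comp del_tobj.
- by rewrite copy_tunit.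
- by rewrite del_tunit.
Defined.

(* A pullback of [copy X] along [i ⊠ j] when [j] is [i] or an identity. *)
Lemma copy_pullback D B X (i : hom D X) (j : hom B X) (k : hom D B) :
  det_mono i -> det_mono j -> i = j ∘ k ->
  is_pullback (copy X) (i ⊠ j) i ((idm D ⊠ k) ∘ copy D).
Proof.
move=> Hi Hj ijk; have [[_ ic] iM] := Hi.
apply: pullback_mono => //; first by case: (det_mono_tmor Hi Hj).
  by rewrite compmA -tmor_comp compm1 -ijk.
move=> W a b e; exists (fstm _ _ ∘ b).
have T := part_markov HC.
rewrite compmA -(fst_nat i (T _ _ j)) -(compmA _ (i ⊠ j)) -e compmA.
by rewrite -[fstm X X]compm1 -tmor_id fst_pair ?comp1m //; apply: T.
Qed.

Lemma Partial_quasi_markov : is_quasi_markov Partial.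
Proof.
move=> X Y; elim/pspan_ind => D i f Hi.
rewrite /quasi_total /= pcomp_inc ptmor_span.
have PB := copy_pullback Hi Hi (esym (compm1 i)).
rewrite -pcompA (pcomp_pinc _ _ Hi PB) pcomp_inc.
apply: pspan_eq1 => //.
rewrite tmor_id comp1m compmA (part_markov HC).
have := fst_pair f (part_markov HC (idm D)).
by rewrite /fstm -(compmA (@runit C Y)) -tmor_comp comp1m compm1.
Qed.

End Partial.

(* Main.v *)
From mathcomp Require Import ssreflect ssrfun.
Require Import Defs.
Local Open Scope cat_scope.

(** In the quasi-Markov category of partial maps, the right-hand side of the
    defining equation of a conditional runs the marginal of [u], keeps a copy
    of its input [A], and feeds both to the candidate conditional.  The
    marginal of [(D, i, f)] is [(D, i, marginal f)], so it is defined on [D]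
    only, and the pullback of [copy A] along [i ⊠ idm A] is [D] itself, with
    the second output being [i]: on the domain of definition, the input that
    was kept has the form [i d] ([partial_pair_idE]).  Hence everything that
    reaches [u_{|X}] factors through its domain [idm X ⊠ i], no further
    restriction of the domain takes place, and the composite is [(D, i, _)]
    with right leg the same expression formed in [C] from [f] and [f_{|X}]
    ([conditional_input_nat]).  That leg is [f] because [f_{|X}] is a
    conditional of [f]. *)

Section PartialConditional.
Variables (C : cdCategory) (HC : partializable C).

(** Copying the marginal and keeping the conditioning input is natural in that
    input; for [i] this exhibits the factorization through [idm X ⊠ i]. *)
Lemma conditional_input_nat (X A D : C) (i : hom D A) (m : hom D X) :
  assoc X X A ∘ (copy X ⊠ idm A) ∘ (m ⊠ i) =
  (idm X ⊠ (idm X ⊠ i)) ∘ (assoc X X D ∘ (copy X ⊠ idm D) ∘ (m ⊠ idm D)).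
Proof.
rewrite !compmA -assoc_nat -!compmA; congr comp.
by rewrite tmor_id -!tmor_comp !comp1m !compm1.
Qed.

(** Restricting one of two copies of [A] to [D] restricts the other one as
    well, since [i] is copyable; so keeping the input of a span leaves its
    domain unchanged and turns the kept copy into [i]. *)
Lemma partial_pair_idE (A D X : C) (i : hom D A) (m : hom D X)
    (Hi : det_mono i) :
  partial_comp HC (ptmor HC (pspan m Hi) (pinc (idm A))) (pinc (copy A)) =
  pspan ((m ⊠ i) ∘ copy D) Hi.
Proof.
rewrite /pinc ptmor_span.
have PB := copy_pullback HC Hi (det_mono_id A) (esym (comp1m i)).
rewrite (pcomp_pinc HC _ _ Hi PB); apply: pspan_eq1 => //.
by rewrite compmA -tmor_comp compm1 comp1m.
Qed.

Lemma Partial_marginalE (A X Y D : C) (i : hom D A) (f : hom D (X ⊗ Y))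
    (Hi : det_mono i) :
  @marginal (Partial HC) X Y A (pspan f Hi) = pspan (marginal f) Hi.
Proof. by rewrite /marginal /= pinc_tmor -pinc_comp pcomp_inc. Qed.

Lemma Partial_is_conditional (A X Y D : C) (i : hom D A)
    (f : hom D (X ⊗ Y)) (fX : hom (X ⊗ D) Y)
    (Hi : det_mono i) (HXi : det_mono (idm X ⊠ i)) :
  is_conditional f fX ->
  @is_conditional (Partial HC) X Y A (pspan f Hi) (pspan fX HXi).
Proof.
move=> fXP; rewrite /is_conditional Partial_marginalE /=.
rewrite -pcompA partial_pair_idE pinc_tmor -!pcompA !pcomp_inc.
rewrite [pinc (idm X)]/pinc ptmor_span.
rewrite (pcomp_fact HC _ _ _
  (f' := assoc X X D ∘ (copy X ⊠ idm D) ∘ (marginal f ⊠ idm D) ∘ copy D)).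
  by apply: pspan_eq1 => //; rewrite {1}fXP !compmA.
by rewrite [LHS]compmA [LHS]compmA conditional_input_nat [RHS]compmA.
Qed.

End PartialConditional.

Theorem proposition1p12 (C : cdCategory) (HC : partializable C)
    (condC : has_conditionals C) :
  (forall (A X Y D : C) (u : @hom (Partial HC) A (X ⊗ Y))
      (i : hom D A) (f : hom D (X ⊗ Y)),
    represents u i f ->
    forall fX : hom (X ⊗ D) Y, is_conditional f fX ->
    exists uX : @hom (Partial HC) (X ⊗ A) Y,
      @is_conditional (Partial HC) X Y A u uX /\
      represents uX (idm X ⊠ i) fX) /\
  has_conditionals (Partial HC).
Proof.
split=> [A X Y D u i f [Hi ->] fX fXP|X Y A].
  have HXi : det_mono (idm X ⊠ i).
    by apply: (det_mono_tmor HC) => //; apply: det_mono_id.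
  exists (pspan fX HXi); split; last by exists HXi.
  exact: Partial_is_conditional.
elim/pspan_ind => D i f Hi; have [fX fXP] := condC _ _ _ f.
have HXi : det_mono (idm (X : C) ⊠ i).
  by apply: (det_mono_tmor HC) => //; apply: det_mono_id.
by exists (pspan fX HXi); apply: Partial_is_conditional.
Qed.
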